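(* Let $G$ be a cyclic group and $p$ be an odd prime. (a) If $|G|=2p$ then $R(\mathcal{B}(G))=(1+\sqrt{3})(1+\sqrt{p^2-1})$, $\mathrm{ABC}(\mathcal{B}(G))=\sqrt{6}+\sqrt{p^2-1}\left(\sqrt{p^2-2}+\sqrt{9p^2-12}\right)$, $\mathrm{GA}(\mathcal{B}(G))=\frac{2+3\sqrt{3}}{2}+\sqrt{(p^2-1)^3}\left(\frac{2}{p^2}+\frac{6\sqrt{3}}{3p^2-2}\right)$, $H(\mathcal{B}(G))=\frac{5}{2}+(p^2-1)\left(\frac{2}{p^2}+\frac{6}{3p^2-2}\right)$ and $\mathrm{SCI}(\mathcal{B}(G))=\frac{1}{\sqrt{2}}+\frac{3}{2}+(p^2-1)\left(\frac{1}{p}+\frac{3}{\sqrt{3p^2-2}}\right)$. (b) If $|G|=2p^2$ then $R(\mathcal{B}(G))=(1+\sqrt{3})(1+(p+1)\sqrt{p^2-1})$, $\mathrm{ABC}(\mathcal{B}(G))=\sqrt{6}+\sqrt{p^2-1}\left(\sqrt{p^2-2}+\sqrt{9p^2-12}+\sqrt{p^6-p^4-p^2}+\sqrt{9p^6-9p^4-3p^2}\right)$, $\mathrm{GA}(\mathcal{B}(G))=\frac{2+3\sqrt{3}}{2}+\sqrt{(p^2-1)^3}\left(\frac{2}{p^2}+\frac{6\sqrt{3}}{3p^2-2}+\frac{2p^3}{p^4-p^2+1}+\frac{6p^3\sqrt{3}}{3p^4-3p^2+1}\right)$, $H(\mathcal{B}(G))=\frac{5}{2}+(p^2-1)\left(\frac{2}{p^2}+\frac{6}{3p^2-2}+\frac{2p^2}{p^4-p^2+1}+\frac{6p^2}{3p^4-3p^2+1}\right)$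 and $\mathrm{SCI}(\mathcal{B}(G))=\frac{1}{\sqrt{2}}+\frac{3}{2}+(p^2-1)\left(\frac{1}{p}+\frac{3}{\sqrt{3p^2-2}}+\frac{p^2}{\sqrt{p^4-p^2+1}}+\frac{3p^2}{\sqrt{3p^4-3p^2+1}}\right)$. (c) If $|G|=4p$ then $R(\mathcal{B}(G))=(1+3\sqrt{3})(1+\sqrt{p^2-1})$, $\mathrm{ABC}(\mathcal{B}(G))=\sqrt{6}+\sqrt{132}+\sqrt{p^2-1}\left(\sqrt{p^2-2}+\sqrt{9p^2-12}+\sqrt{144p^2-156}\right)$, $\mathrm{GA}(\mathcal{B}(G))=\frac{26+135\sqrt{3}}{26}+\sqrt{(p^2-1)^3}\left(\frac{2}{p^2}+\frac{6\sqrt{3}}{3p^2-2}+\frac{48\sqrt{3}}{12p^2-11}\right)$, $H(\mathcal{B}(G))=\frac{113}{26}+(p^2-1)\left(\frac{2}{p^2}+\frac{6}{3p^2-2}+\frac{24}{12p^2-11}\right)$ and $\mathrm{SCI}(\mathcal{B}(G))=\frac{1}{\sqrt{2}}+\frac{3}{2}+\frac{12}{\sqrt{13}}+(p^2-1)\left(\frac{1}{p}+\frac{3}{\sqrt{3p^2-2}}+\frac{12}{\sqrt{12p^2-11}}\right)$. (d) If $|G|=4p^2$ then $R(\mathcal{B}(G))=(1+3\sqrt{3})(1+(p+1)\sqrt{p^2-1})$, $\mathrm{ABC}(\mathcal{B}(G))=\sqrt{6}+\sqrt{132}+\sqrt{p^2-1}\left(\sqrt{p^2-2}+\sqrt{9p^2-12}+\sqrt{144p^2-156}+\sqrt{p^6-p^4-p^2}+\sqrt{9p^6-9p^4-3p^2}+\sqrt{144p^6-144p^4-12p^2}\right)$,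 $\mathrm{GA}(\mathcal{B}(G))=\frac{26+135\sqrt{3}}{26}+\sqrt{(p^2-1)^3}\left(\frac{2}{p^2}+\frac{6\sqrt{3}}{3p^2-2}+\frac{48\sqrt{3}}{12p^2-11}+\frac{2p^3}{p^4-p^2+1}+\frac{6p^3\sqrt{3}}{3p^4-3p^2+1}+\frac{48p^3\sqrt{3}}{12p^4-12p^2+1}\right)$, $H(\mathcal{B}(G))=\frac{113}{26}+(p^2-1)\left(\frac{2}{p^2}+\frac{6}{3p^2-2}+\frac{24}{12p^2-11}+\frac{2p^2}{p^4-p^2+1}+\frac{6p^2}{3p^4-3p^2+1}+\frac{24p^2}{12p^4-12p^2+1}\right)$ and $\mathrm{SCI}(\mathcal{B}(G))=\frac{1}{\sqrt{2}}+\frac{3}{2}+\frac{12}{\sqrt{13}}+(p^2-1)\left(\frac{1}{p}+\frac{3}{\sqrt{3p^2-2}}+\frac{12}{\sqrt{12p^2-11}}+\frac{p^2}{\sqrt{p^4-p^2+1}}+\frac{3p^2}{\sqrt{3p^4-3p^2+1}}+\frac{12p^2}{\sqrt{12p^4-12p^2+1}}\right)$.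
   Context: For a finite group $G$, $L(G)$ denotes the set of all subgroups of $G$. The subgroup generating bipartite graph $\mathcal{B}(G)$ is the simple undirected bipartite graph whose vertex set is the disjoint union $(G\times G)\sqcup L(G)$, where $(a,b)\in G\times G$ and $H\in L(G)$ are adjacent if and only if $H=\langle a,b\rangle$ (the subgroup generated by $a$ and $b$); there are no other edges. For a finite simple graph $\mathcal{G}$ with edge set $e(\mathcal{G})$, writing $d(u)$ for the degree of $u$ in $\mathcal{G}$: the Randic Connectivity index is $R(\mathcal{G})=\sum_{uv\in e(\mathcal{G})}(d(u)d(v))^{-1/2}$; the Atom-Bond Connectivity index is $\mathrm{ABC}(\mathcal{G})=\sum_{uv\in e(\mathcal{G})}\left(\frac{d(u)+d(v)-2}{d(u)d(v)}\right)^{1/2}$; the Geometric-Arithmetic index is $\mathrm{GA}(\mathcal{G})=\sum_{uv\in e(\mathcal{G})}\frac{\sqrt{d(u)d(v)}}{\frac12(d(u)+d(v))}$; the Harmonic index is $H(\mathcal{G})=\sum_{uv\in e(\mathcal{G})}\frac{2}{d(u)+d(v)}$; the Sum-Connectivity index is $\mathrm{SCI}(\mathcal{G})=\sum_{uv\in e(\mathcal{G})}(d(u)+d(v))^{-1/2}$. *)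

(* Defs.v *)
From HB Require Import structures.
From mathcomp Require Import all_boot all_order all_algebra all_fingroup all_solvable.

Set Implicit Arguments.
Unset Strict Implicit.
Unset Printing Implicit Defensive.

Import Order.TTheory GRing.Theory Num.Theory.
Local Open Scope ring_scope.

Record sgraph := SGraph {
  vertex : finType;
  adj : rel vertex;
  adj_sym : symmetric adj;
  adj_irr : irreflexive adj }.

Definition deg (Gr : sgraph) (u : vertex Gr) : nat := #|[set v | adj u v]|.

(* An edge uv is the two-element set {u, v}, so that it is counted once. *)
Definition edges (Gr : sgraph) : {set {set vertex Gr}} :=
  [set e | [exists u, exists v, adj u v && (e == [set u; v])]].

Section TopologicalIndices.
Variables (R : rcfType) (Gr : sgraph).
Implicit Type e : {set vertex Gr}.

(* For an edge e = {u, v} we have u != v, hence the following are d(u) d(v)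
   and d(u) + d(v). They are taken in R, where subtraction is not truncated. *)
Definition degprod e : R := \prod_(u in e) (deg u)%:R.
Definition degsum e : R := \sum_(u in e) (deg u)%:R.

Definition randic : R :=
  \sum_(e in edges Gr) (Num.sqrt (degprod e))^-1.

Definition atom_bond : R :=
  \sum_(e in edges Gr) Num.sqrt ((degsum e - 2) / degprod e).

Definition geom_arith : R :=
  \sum_(e in edges Gr) Num.sqrt (degprod e) / (2^-1 * degsum e).

Definition harmonic : R :=
  \sum_(e in edges Gr) 2 / degsum e.

Definition sum_connectivity : R :=
  \sum_(e in edges Gr) (Num.sqrt (degsum e))^-1.

End TopologicalIndices.

Section SubgroupGeneratingBipartiteGraph.
Variables (gT : finGroupType) (G : {group gT}).

Definition sgb_vertex : finType :=
  ((subg_of G * subg_of G) + {H : {group gT} | H \in subgroups G})%type.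

Definition sgb_adj : rel sgb_vertex := fun x y =>
  match x, y with
  | inl (a, b), inr H | inr H, inl (a, b) =>
      (sval H : {set gT}) == <<[set sgval a; sgval b]>>%g
  | _, _ => false
  end.

Lemma sgb_adj_sym : symmetric sgb_adj.
Proof. by move=> [[a b]|H] [[c d]|K]. Qed.

Lemma sgb_adj_irr : irreflexive sgb_adj.
Proof. by move=> [[a b]|H]. Qed.

Definition sgb_graph : sgraph := SGraph sgb_adj_sym sgb_adj_irr.

End SubgroupGeneratingBipartiteGraph.

(* Main.v *)
Require Import Defs.
From HB Require Import structures.
From mathcomp Require Import all_boot all_order all_algebra all_fingroup all_solvable.
From mathcomp Require Import ring lra.

Set Implicit Arguments.
Unset Strict Implicit.
Unset Printing Implicit Defensive.

Import Order.TTheory GRing.Theory Num.Theory.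
Local Open Scope ring_scope.

(** Every pair (a, b) lies on the single edge joining it to <a, b>, so it has
    degree 1 and the edges of the graph are indexed by the pairs.  A subgroup H
    has as degree the number of pairs that generate it.  When G is cyclic, a
    subgroup is determined by its order, so this degree is the number
    [npairs d] of pairs generating a subgroup of order d = #|H|, and a sum over
    the edges of a function of the degrees becomes a sum over the divisors d
    of #|G|, in which the degrees (1, npairs d) occur npairs d times
    ([sum_edges_cyclic]).

    The pairs that generate a subgroup of order dividing n are the pairs of
    elements of the unique subgroup of order n.  Hence the sum of npairs d over
    the divisors d of n is n ^ 2 ([sum_npairs]), the identity that
    characterizes the Jordan totient J_2.  For #|G| = r ^ m * p ^ n, with r and
    p distinct primes, the sums over divisors are double sums over exponents,
    and inverting them gives npairs (r ^ i * p ^ j) =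
    J_2(r ^ i) J_2(p ^ j) ([npairs_prime2]).

    For r = 2 the first factor is 1, 3 or 12, and the second is 1, p ^ 2 - 1 or
    p ^ 2 (p ^ 2 - 1).  What remains is to extract the squares under the
    radicals, so that only sqrt 3, sqrt (p ^ 2 - 1) and radicals that are the
    same on both sides are left, and to compare rational expressions. *)

(** * Divisors of a product of two prime powers *)

Section Divisors.

Lemma perm_divisorsM (m n : nat) : (0 < m)%N -> (0 < n)%N -> coprime m n ->
  perm_eq (divisors (m * n))
          [seq (a * b)%N | a <- divisors m, b <- divisors n].
Proof.
move=> m0 n0 co_mn; have mn0 : (0 < m * n)%N by rewrite muln_gt0 m0.
apply: uniq_perm; first exact: divisors_uniq.
- apply: allpairs_uniq; [exact: divisors_uniq | exact: divisors_uniq |].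
  (* The first factor of a * b is recovered as gcd(a * b, m). *)
  have gcdl a b : (a %| m)%N -> (b %| n)%N ->
      (gcdn (a * b) m = a) * (gcdn (a * b) n = b).
    move=> am bn; split.
      rewrite gcdnC Gauss_gcdl; first exact/gcdn_idPr.
      exact: coprime_dvdr bn co_mn.
    rewrite gcdnC Gauss_gcdr; first exact/gcdn_idPr.
    by rewrite coprime_sym; apply: coprime_dvdl am co_mn.
  move=> x y /allpairsP[[a b] /= [ha hb ->]] /allpairsP[[c d] /= [hc hd ->]].
  move: ha hb hc hd; rewrite -!dvdn_divisors // => ha hb hc hd /= eq_prod.
  by rewrite -(gcdl a b ha hb).1 -{2}(gcdl a b ha hb).2 eq_prod !gcdl.
- move=> d; rewrite -dvdn_divisors //; apply/idP/allpairsP.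
  + move=> dvd_d; exists (gcdn d m, gcdn d n) => /=.
    rewrite -!dvdn_divisors // !dvdn_gcdr; split=> //.
    apply/eqP; rewrite eqn_dvd; apply/andP; split.
      rewrite muln_gcdr !muln_gcdl !dvdn_gcd dvd_d.
      by rewrite !(dvdn_mulr _ (dvdnn d)) dvdn_mull.
    rewrite Gauss_dvd ?dvdn_gcdl //.
    apply: coprime_dvdl (dvdn_gcdr d m) _.
    exact: coprime_dvdr (dvdn_gcdr d n) co_mn.
  + case=> -[a b] /= []; rewrite -!dvdn_divisors // => am bn ->.
    exact: dvdn_mul.
Qed.

Lemma perm_divisorsX (r k : nat) : prime r ->
  perm_eq (divisors (r ^ k)) [seq (r ^ i)%N | i <- iota 0 k.+1].
Proof.
move=> r_pr; apply: uniq_perm; first exact: divisors_uniq.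
  by rewrite map_inj_uniq ?iota_uniq //; apply/expnI/prime_gt1.
move=> d; rewrite -dvdn_divisors ?expn_gt0 ?prime_gt0 //.
apply/(dvdn_pfactor _ _ r_pr)/mapP => -[i le_ik ->]; exists i => //.
  by rewrite mem_iota.
by rewrite mem_iota in le_ik.
Qed.

Lemma sum_divisors_prime2 (V : nmodType) (F : nat -> V) (r p m n : nat) :
    prime r -> prime p -> r != p ->
  \sum_(d <- divisors (r ^ m * p ^ n)) F d =
    \sum_(i < m.+1) \sum_(j < n.+1) F (r ^ i * p ^ j)%N.
Proof.
move=> r_pr p_pr neq_rp.
have co : coprime (r ^ m) (p ^ n).
  by rewrite coprimeXl ?coprimeXr // prime_coprime // dvdn_prime2.
rewrite (perm_big _ (perm_divisorsM _ _ co)) ?expn_gt0 ?prime_gt0 //=.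
rewrite big_allpairs_dep (perm_big _ (perm_divisorsX m r_pr)) big_map.
rewrite -[m.+1]subn0 -/(index_iota 0 m.+1) big_mkord subn0; apply: eq_bigr => i _.
rewrite (perm_big _ (perm_divisorsX n p_pr)) big_map.
by rewrite -[n.+1]subn0 -/(index_iota 0 n.+1) big_mkord subn0.
Qed.

End Divisors.

(** * The Jordan totient J_2 on products of two prime powers *)

Section Jordan.
Variable R : comNzRingType.

(** The value of J_2 at the prime power x ^ i, with the prime taken in a ring
    so that the subtraction is not truncated. *)
Definition jordan2_pfactor (x : R) (i : nat) : R :=
  if i is i'.+1 then x ^+ (2 * i) - x ^+ (2 * i') else 1.
Arguments jordan2_pfactor : simpl never.

Lemma eq_partial_sums (f g : nat -> R) (n : nat) :
    (forall i, (i <= n)%N -> \sum_(k < i.+1) f k = \sum_(k < i.+1) g k) ->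
  forall i, (i <= n)%N -> f i = g i.
Proof.
move=> eq_sum [|i] le_in; first by have := eq_sum 0 le_in; rewrite !big_ord1.
have := eq_sum i.+1 le_in; rewrite big_ord_recr [in RHS]big_ord_recr /=.
by rewrite (eq_sum i (ltnW le_in)) => /addrI.
Qed.

Lemma sum_jordan2_pfactor (x : R) (n : nat) :
  \sum_(i < n.+1) jordan2_pfactor x i = x ^+ (2 * n).
Proof.
elim: n => [|n IHn]; first by rewrite big_ord1.
by rewrite big_ord_recr IHn /jordan2_pfactor /= addrC subrK.
Qed.

(** Moebius inversion on the grid of exponents: partial sums determine their
    terms, first in the second index and then in the first. *)
Lemma jordan2_unique (f : nat -> nat -> R) (x y : R) (m n : nat) :
    (forall i j, (i <= m)%N -> (j <= n)%N ->
       \sum_(a < i.+1) \sum_(b < j.+1) f a b = x ^+ (2 * i) * y ^+ (2 * j)) ->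
  forall i j, (i <= m)%N -> (j <= n)%N ->
    f i j = jordan2_pfactor x i * jordan2_pfactor y j.
Proof.
move=> sum_f i j le_im; move: j.
apply: (@eq_partial_sums (f i) _ n) => j le_jn; rewrite -mulr_sumr.
rewrite sum_jordan2_pfactor; move: i le_im.
apply: (@eq_partial_sums (fun i => \sum_(b < j.+1) f i b)) => i le_im.
by rewrite sum_f // -mulr_suml sum_jordan2_pfactor.
Qed.

End Jordan.
Arguments jordan2_pfactor : simpl never.

(** * Edges and degrees in the graph of a cyclic group *)

Section CyclicGraph.
Variables (gT : finGroupType) (G : {group gT}).
Local Notation pairT := (subg_of G * subg_of G)%type.

Lemma gen_pair_subgroups (ab : pairT) :
  <<[set sgval ab.1; sgval ab.2]>>%G \in subgroups G.
Proof. by rewrite inE gen_subG subUset !sub1set !subgP. Qed.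

Definition gen_pair (ab : pairT) : {H : {group gT} | H \in subgroups G} :=
  Sub <<[set sgval ab.1; sgval ab.2]>>%G (gen_pair_subgroups ab).

Definition pair_order (ab : pairT) : nat := #|sval (gen_pair ab)|.

Definition npairs (d : nat) : nat := #|[set ab | pair_order ab == d]|.

Lemma sgb_adj_pair (ab : pairT) (v : sgb_vertex G) :
  sgb_adj (inl ab) v = (v == inr (gen_pair ab)).
Proof. by case: ab v => a b [ab|H] //=. Qed.

Lemma edgesE :
  edges (sgb_graph G) =
    [set [set (inl ab : vertex (sgb_graph G)); inr (gen_pair ab)] | ab : pairT].
Proof.
apply/setP=> e; rewrite inE; apply/existsP/imsetP.
  move=> [u /existsP[v /andP[]]].
  case: u => [ab|H] /=.
    by rewrite -/(sgb_adj (inl ab) v) sgb_adj_pair => /eqP-> /eqP->; exists ab.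
  rewrite -/(sgb_adj (inr H) v) sgb_adj_sym; case: v => [ab|//].
  rewrite sgb_adj_pair => /eqP[->] /eqP->; exists ab => //.
  by rewrite setUC.
move=> [ab _ ->]; exists (inl ab); apply/existsP; exists (inr (gen_pair ab)).
by rewrite eqxx andbT [adj _ _]sgb_adj_pair.
Qed.

(** The pair is recovered as the only left vertex of its edge. *)
Lemma edge_of_pair_inj :
  injective (fun ab : pairT =>
    [set (inl ab : vertex (sgb_graph G)); inr (gen_pair ab)]).
Proof.
move=> ab cd /setP/(_ (inl ab)); rewrite !inE eqxx /= orbF.
by move=> /esym/eqP[].
Qed.

Lemma deg_pair (ab : pairT) : deg (inl ab : vertex (sgb_graph G)) = 1%N.
Proof.
rewrite /deg (_ : [set v | _] = [set inr (gen_pair ab)]) ?cards1 //.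
by apply/setP=> v; rewrite !inE; apply: sgb_adj_pair.
Qed.

(** Cyclicity enters here: two subgroups of G with the same order coincide, so
    the pairs generating <a, b> are counted by the order of <a, b> alone. *)
Lemma deg_gen_pair (ab : pairT) : cyclic G ->
  deg (inr (gen_pair ab) : vertex (sgb_graph G)) = npairs (pair_order ab).
Proof.
move=> cycG; rewrite /deg /npairs.
rewrite -(card_imset [set cd | pair_order cd == _]
                     (@inl_inj _ {H | H \in subgroups G})).
congr #|pred_of_set _|; apply/setP=> -[cd|K]; rewrite inE.
  rewrite mem_imset; last exact: inl_inj.
  rewrite inE; case: cd => c d /=; rewrite /pair_order.
  have sub ef : sval (gen_pair ef) \subset G.
    by have := valP (gen_pair ef); rewrite inE.
  by rewrite -(eq_subG_cyclic cycG) // eq_sym.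
by apply/esym/negbTE/imsetP => -[].
Qed.

Lemma pair_order_dvd (ab : pairT) : (pair_order ab %| #|G|)%N.
Proof. by apply: cardSg; have := valP (gen_pair ab); rewrite inE. Qed.

Lemma sum_by_pair_order (V : nmodType) (n : nat) (F : nat -> V) : (0 < n)%N ->
  \sum_(ab | (pair_order ab %| n)%N) F (pair_order ab) =
    \sum_(d <- divisors n) F d *+ npairs d.
Proof.
move=> n_gt0.
transitivity (\sum_(ab | (pair_order ab %| n)%N)
                \sum_(d <- divisors n | d == pair_order ab) F d).
  apply: eq_bigr => ab; rewrite dvdn_divisors // => ab_n.
  by rewrite -big_filter filter_pred1_uniq ?divisors_uniq // big_seq1.
rewrite (exchange_big_dep xpredT) //= !big_seq; apply: eq_bigr => d.
rewrite -dvdn_divisors // => d_n; rewrite sumr_const; congr (_ *+ _).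
rewrite -[RHS]cardsE; apply: eq_card => ab; rewrite !inE.
rewrite unfold_in eq_sym.
by case: (eqVneq (pair_order ab) d) => [->|]; rewrite ?d_n ?andbF.
Qed.

(** The edge at the pair ab has degree product npairs d and degree sum
    1 + npairs d, where d is the order of <a, b>; grouping the pairs by d
    makes npairs d reappear as a multiplicity. *)
Lemma sum_edges_cyclic (R : rcfType) (F : R -> R -> R) : cyclic G ->
  \sum_(e in edges (sgb_graph G)) F (degprod R e) (degsum R e) =
    \sum_(d <- divisors #|G|)
      (npairs d)%:R * F (npairs d)%:R (1 + (npairs d)%:R).
Proof.
move=> cycG; rewrite edgesE big_imset /=; last exact: in2W edge_of_pair_inj.
pose w m := F m%:R (1 + m%:R).
transitivity (\sum_(ab | (pair_order ab %| #|G|)%N) w (npairs (pair_order ab))).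
  apply: eq_big => [ab|ab _]; first by rewrite pair_order_dvd.
  rewrite /degprod /degsum !big_setU1 ?inE //= !big_set1.
  by rewrite deg_pair deg_gen_pair // mulr1n mul1r.
rewrite (@sum_by_pair_order _ _ (fun d => w (npairs d))) ?cardG_gt0 //.
by apply: eq_bigr => d _; rewrite mulr_natl.
Qed.

(** In a cyclic group <a, b> has order dividing n exactly when a and b both
    lie in the subgroup H of order n, which leaves n ^ 2 pairs. *)
Lemma sum_npairs (n : nat) : cyclic G -> (n %| #|G|)%N ->
  (\sum_(d <- divisors n) npairs d = n ^ 2)%N.
Proof.
move=> /cyclicP[x defG] dvd_n; have n_gt0 := dvdn_gt0 (cardG_gt0 G) dvd_n.
have [H sHG oH] : exists2 H : {group gT}, H \subset G & #|H| = n.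
  have ox : #[x]%g = #|G| by rewrite defG.
  exists <[x ^+ (#|G| %/ n)]>%G; first by rewrite defG cycleX.
  by rewrite -orderE orderXdiv ox ?dvdn_div // divnA // mulKn.
transitivity (\sum_(ab | (pair_order ab %| n)%N) 1)%N.
  have := sum_by_pair_order (fun=> 1%N) n_gt0; rewrite /= => ->.
  by apply: eq_bigr => d _; rewrite -[LHS]natn.
rewrite sum1_card.
pose HG := [set a : subg_of G | sgval a \in H].
have oHG : #|HG| = n.
  rewrite -oH -(card_imset HG subg_inj); apply: eq_card => y; apply/imsetP/idP.
    by case=> a; rewrite inE => ? ->.
  move=> yH; exists (subg G y); rewrite ?inE subgK //; exact: (subsetP sHG).
transitivity (#|HG| * #|HG|)%N; last by rewrite oHG.
rewrite -cardsX; apply: eq_card => ab.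
rewrite -[LHS]/(pair_order ab %| n)%N !inE /pair_order /= -oH.
rewrite (@cardSg_cyclic _ G) //.
- by rewrite gen_subG subUset !sub1set.
- by apply/cyclicP; exists x.
- by have := gen_pair_subgroups ab; rewrite inE.
Qed.

(** [sum_npairs] at the divisor r ^ i * p ^ j gives the double partial sums
    that characterize the product of the two values of J_2. *)
Lemma npairs_prime2 (R : comNzRingType) (r p m n i j : nat) :
    cyclic G -> prime r -> prime p -> r != p -> #|G| = (r ^ m * p ^ n)%N ->
    (i <= m)%N -> (j <= n)%N ->
  (npairs (r ^ i * p ^ j))%:R =
    jordan2_pfactor r%:R i * jordan2_pfactor p%:R j :> R.
Proof.
move=> cycG r_pr p_pr neq_rp oG; move: i j.
apply: (@jordan2_unique R (fun i j => (npairs (r ^ i * p ^ j))%:R)).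
move=> i j le_im le_jn.
under eq_bigr do rewrite -natr_sum; rewrite -natr_sum.
rewrite -(@sum_divisors_prime2 _ npairs) // sum_npairs //.
  by rewrite natrX natrM !natrX exprMn -!exprM ![(_ * 2)%N]mulnC.
by rewrite oG dvdn_mul // dvdn_exp2l.
Qed.

Lemma sum_edges_prime2 (R : rcfType) (F : R -> R -> R) (r p m n : nat) :
    cyclic G -> prime r -> prime p -> r != p -> #|G| = (r ^ m * p ^ n)%N ->
  \sum_(e in edges (sgb_graph G)) F (degprod R e) (degsum R e) =
    \sum_(i < m.+1) \sum_(j < n.+1)
      (let D := jordan2_pfactor r%:R i * jordan2_pfactor p%:R j in
       D * F D (1 + D)).
Proof.
move=> cycG r_pr p_pr neq_rp oG.
rewrite sum_edges_cyclic // oG sum_divisors_prime2 //.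
apply: eq_bigr => i _; apply: eq_bigr => j _ /=.
by rewrite (npairs_prime2 _ cycG r_pr p_pr neq_rp oG) // -ltnS.
Qed.

End CyclicGraph.

(** * The indices when the order has two prime divisors *)

Section Indices.
Variables (R : rcfType) (gT : finGroupType) (G : {group gT}).
Variables (r p m n : nat).
Hypotheses (cycG : cyclic G) (r_pr : prime r) (p_pr : prime p).
Hypotheses (neq_rp : r != p) (oG : #|G| = (r ^ m * p ^ n)%N).

Local Notation B := (sgb_graph G).
Local Notation D i j :=
  (jordan2_pfactor (r%:R : R) i * jordan2_pfactor (p%:R : R) j).

Lemma jordan2_pfactor_gt0 (l i : nat) :
  prime l -> 0 < jordan2_pfactor (l%:R : R) i.
Proof.
rewrite /jordan2_pfactor; case: i => [|i] l_pr; rewrite ?ltr01 // subr_gt0 ltr_eXn2l.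
  by rewrite ltn_mul2l ltnSn.
by rewrite ltr1n prime_gt1.
Qed.

Lemma jordan2_pfactorM_gt0 i j : 0 < D i j.
Proof. by rewrite mulr_gt0 ?jordan2_pfactor_gt0. Qed.

Let idx_sum F := @sum_edges_prime2 _ _ R F _ _ _ _ cycG r_pr p_pr neq_rp oG.

Lemma randic_prime2 : randic R B =
  (\sum_(i < m.+1) Num.sqrt (jordan2_pfactor (r%:R : R) i)) *
  (\sum_(j < n.+1) Num.sqrt (jordan2_pfactor (p%:R : R) j)).
Proof.
rewrite big_distrlr [LHS](idx_sum (fun x _ => (Num.sqrt x)^-1)) /=.
apply: eq_bigr => i _; apply: eq_bigr => j _; have x0 := jordan2_pfactorM_gt0 i j.
rewrite -sqrtrM ?ltW ?jordan2_pfactor_gt0 //.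
by rewrite -{1}[D i j]sqr_sqrtr ?ltW // expr2 mulfK // gt_eqF ?sqrtr_gt0.
Qed.

Lemma atom_bond_prime2 : atom_bond R B =
  \sum_(i < m.+1) \sum_(j < n.+1) Num.sqrt (D i j) * Num.sqrt (D i j - 1).
Proof.
rewrite [LHS](idx_sum (fun x y => Num.sqrt ((y - 2) / x))) /=.
apply: eq_bigr => i _; apply: eq_bigr => j _; have := jordan2_pfactorM_gt0 i j.
move: (D i j) => x x_gt0.
(* The multiplicity x enters the radical as x ^ 2. *)
rewrite -{1}(ger0_norm (ltW x_gt0)) -sqrtr_sqr -!sqrtrM ?sqr_ge0 ?ltW //.
by congr Num.sqrt; field; rewrite gt_eqF.
Qed.

Lemma geom_arith_prime2 : geom_arith R B =
  \sum_(i < m.+1) \sum_(j < n.+1) 2 * D i j * Num.sqrt (D i j) / (1 + D i j).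
Proof.
rewrite [LHS](idx_sum (fun x y => Num.sqrt x / (2^-1 * y))) /=.
apply: eq_bigr => i _; apply: eq_bigr => j _; have := jordan2_pfactorM_gt0 i j.
by move: (D i j) => x x_gt0; field; rewrite gt_eqF // addr_gt0.
Qed.

Lemma harmonic_prime2 : harmonic R B =
  \sum_(i < m.+1) \sum_(j < n.+1) 2 * D i j / (1 + D i j).
Proof.
rewrite [LHS](idx_sum (fun x y => 2 / y)) /=.
by apply: eq_bigr => i _; apply: eq_bigr => j _; rewrite mulrCA mulrA.
Qed.

Lemma sum_connectivity_prime2 : sum_connectivity R B =
  \sum_(i < m.+1) \sum_(j < n.+1) D i j / Num.sqrt (1 + D i j).
Proof. exact: (idx_sum (fun x y => (Num.sqrt y)^-1)). Qed.

End Indices.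

Theorem theorem4p2 (R : rcfType) (gT : finGroupType) (G : {group gT}) (p : nat)
    (cycG : cyclic G) (p_prime : prime p) (p_odd : odd p) :
  let B := sgb_graph G in
  let q : R := p%:R in
  let s : R -> R := Num.sqrt in
  [/\ (#|G| = 2 * p)%N ->
      [/\ randic R B = (1 + s 3) * (1 + s (q ^+ 2 - 1)),
          atom_bond R B =
            s 6 + s (q ^+ 2 - 1) * (s (q ^+ 2 - 2) + s (9 * q ^+ 2 - 12)),
          geom_arith R B =
            (2 + 3 * s 3) / 2
            + s ((q ^+ 2 - 1) ^+ 3)
              * (2 / q ^+ 2 + 6 * s 3 / (3 * q ^+ 2 - 2)),
          harmonic R B =
            5 / 2 + (q ^+ 2 - 1) * (2 / q ^+ 2 + 6 / (3 * q ^+ 2 - 2)) &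
          sum_connectivity R B =
            1 / s 2 + 3 / 2
            + (q ^+ 2 - 1) * (1 / q + 3 / s (3 * q ^+ 2 - 2))],
      (#|G| = 2 * p ^ 2)%N ->
      [/\ randic R B = (1 + s 3) * (1 + (q + 1) * s (q ^+ 2 - 1)),
          atom_bond R B =
            s 6 + s (q ^+ 2 - 1)
              * (s (q ^+ 2 - 2) + s (9 * q ^+ 2 - 12)
                 + s (q ^+ 6 - q ^+ 4 - q ^+ 2)
                 + s (9 * q ^+ 6 - 9 * q ^+ 4 - 3 * q ^+ 2)),
          geom_arith R B =
            (2 + 3 * s 3) / 2
            + s ((q ^+ 2 - 1) ^+ 3)
              * (2 / q ^+ 2 + 6 * s 3 / (3 * q ^+ 2 - 2)
                 + 2 * q ^+ 3 / (q ^+ 4 - q ^+ 2 + 1)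
                 + 6 * q ^+ 3 * s 3 / (3 * q ^+ 4 - 3 * q ^+ 2 + 1)),
          harmonic R B =
            5 / 2 + (q ^+ 2 - 1)
              * (2 / q ^+ 2 + 6 / (3 * q ^+ 2 - 2)
                 + 2 * q ^+ 2 / (q ^+ 4 - q ^+ 2 + 1)
                 + 6 * q ^+ 2 / (3 * q ^+ 4 - 3 * q ^+ 2 + 1)) &
          sum_connectivity R B =
            1 / s 2 + 3 / 2
            + (q ^+ 2 - 1)
              * (1 / q + 3 / s (3 * q ^+ 2 - 2)
                 + q ^+ 2 / s (q ^+ 4 - q ^+ 2 + 1)
                 + 3 * q ^+ 2 / s (3 * q ^+ 4 - 3 * q ^+ 2 + 1))],
      (#|G| = 4 * p)%N ->
      [/\ randic R B = (1 + 3 * s 3) * (1 + s (q ^+ 2 - 1)),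
          atom_bond R B =
            s 6 + s 132 + s (q ^+ 2 - 1)
              * (s (q ^+ 2 - 2) + s (9 * q ^+ 2 - 12)
                 + s (144 * q ^+ 2 - 156)),
          geom_arith R B =
            (26 + 135 * s 3) / 26
            + s ((q ^+ 2 - 1) ^+ 3)
              * (2 / q ^+ 2 + 6 * s 3 / (3 * q ^+ 2 - 2)
                 + 48 * s 3 / (12 * q ^+ 2 - 11)),
          harmonic R B =
            113 / 26 + (q ^+ 2 - 1)
              * (2 / q ^+ 2 + 6 / (3 * q ^+ 2 - 2)
                 + 24 / (12 * q ^+ 2 - 11)) &
          sum_connectivity R B =
            1 / s 2 + 3 / 2 + 12 / s 13
            + (q ^+ 2 - 1)
              * (1 / q + 3 / s (3 * q ^+ 2 - 2)
                 + 12 / s (12 * q ^+ 2 - 11))] &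
      (#|G| = 4 * p ^ 2)%N ->
      [/\ randic R B = (1 + 3 * s 3) * (1 + (q + 1) * s (q ^+ 2 - 1)),
          atom_bond R B =
            s 6 + s 132 + s (q ^+ 2 - 1)
              * (s (q ^+ 2 - 2) + s (9 * q ^+ 2 - 12)
                 + s (144 * q ^+ 2 - 156)
                 + s (q ^+ 6 - q ^+ 4 - q ^+ 2)
                 + s (9 * q ^+ 6 - 9 * q ^+ 4 - 3 * q ^+ 2)
                 + s (144 * q ^+ 6 - 144 * q ^+ 4 - 12 * q ^+ 2)),
          geom_arith R B =
            (26 + 135 * s 3) / 26
            + s ((q ^+ 2 - 1) ^+ 3)
              * (2 / q ^+ 2 + 6 * s 3 / (3 * q ^+ 2 - 2)
                 + 48 * s 3 / (12 * q ^+ 2 - 11)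
                 + 2 * q ^+ 3 / (q ^+ 4 - q ^+ 2 + 1)
                 + 6 * q ^+ 3 * s 3 / (3 * q ^+ 4 - 3 * q ^+ 2 + 1)
                 + 48 * q ^+ 3 * s 3 / (12 * q ^+ 4 - 12 * q ^+ 2 + 1)),
          harmonic R B =
            113 / 26 + (q ^+ 2 - 1)
              * (2 / q ^+ 2 + 6 / (3 * q ^+ 2 - 2)
                 + 24 / (12 * q ^+ 2 - 11)
                 + 2 * q ^+ 2 / (q ^+ 4 - q ^+ 2 + 1)
                 + 6 * q ^+ 2 / (3 * q ^+ 4 - 3 * q ^+ 2 + 1)
                 + 24 * q ^+ 2 / (12 * q ^+ 4 - 12 * q ^+ 2 + 1)) &
          sum_connectivity R B =
            1 / s 2 + 3 / 2 + 12 / s 13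
            + (q ^+ 2 - 1)
              * (1 / q + 3 / s (3 * q ^+ 2 - 2)
                 + 12 / s (12 * q ^+ 2 - 11)
                 + q ^+ 2 / s (q ^+ 4 - q ^+ 2 + 1)
                 + 3 * q ^+ 2 / s (3 * q ^+ 4 - 3 * q ^+ 2 + 1)
                 + 12 * q ^+ 2 / s (12 * q ^+ 4 - 12 * q ^+ 2 + 1))]].
Proof.
move=> B q s.
have q_ge3 : 3 <= q by rewrite ler_nat odd_prime_gt2.
have q_gt0 : 0 < q by lra.
have neq_2p : 2%N != p by apply: contraTneq p_odd => <-.
have pr2 : prime 2 by [].
set x := q ^+ 2 - 1.
have x_gt0 : 0 < x by rewrite /x; nra.
(* The values of J_2 at the powers of 2 and of p. *)
have jE : (jordan2_pfactor (2 : R) 0 = 1) * (jordan2_pfactor (2 : R) 1 = 3) *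
    (jordan2_pfactor (2 : R) 2 = 12) * (jordan2_pfactor q 0 = 1) *
    (jordan2_pfactor q 1 = x) * (jordan2_pfactor q 2 = q ^+ 2 * x).
  by do ![split]; rewrite /jordan2_pfactor /x //; ring.
have s0 : s 0 = 0 by exact: sqrtr0.
have s1 : s 1 = 1 by exact: sqrtr1.
have s_gt0 y : (0 < s y) = (0 < y) by exact: sqrtr_gt0.
have sX y z : 0 <= y -> s (y ^+ 2 * z) = y * s z.
  by move=> y0; rewrite /s sqrtrM ?sqr_ge0 // sqrtr_sqr ger0_norm.
have s3M y : s (3 * y) = s 3 * s y by rewrite /s sqrtrM.
have s12 : s 12 = 2 * s 3 by rewrite -sX //; congr s; ring.
have s12M y : s (12 * y) = 2 * s 3 * s y by rewrite -s12 /s sqrtrM.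
have sqM y : s (q ^+ 2 * y) = q * s y by rewrite sX // ltW.
have sq : s (q ^+ 2) = q by rewrite -[q ^+ 2]mulr1 sqM s1 mulr1.
have s4 : s 4 = 2.
  by rewrite (_ : 4 = 2 ^+ 2 * 1 :> R) ?sX ?s1 ?mulr1 //; ring.
have sx3 : s (x ^+ 3) = x * s x by rewrite -sX ?ltW // -exprSr.
(* The sums of degrees 1 + J_2(d), in the form of the stated denominators. *)
have dE : (1 + x = q ^+ 2) * (1 + 3 * x = 3 * q ^+ 2 - 2) *
    (1 + 12 * x = 12 * q ^+ 2 - 11) *
    (1 + q ^+ 2 * x = q ^+ 4 - q ^+ 2 + 1) *
    (1 + 3 * (q ^+ 2 * x) = 3 * q ^+ 4 - 3 * q ^+ 2 + 1) *
    (1 + 12 * (q ^+ 2 * x) = 12 * q ^+ 4 - 12 * q ^+ 2 + 1) *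
    (1 + 1 = 2 :> R) * (1 + 3 = 4 :> R) * (1 + 12 = 13 :> R).
  by do ![split]; rewrite /x; ring.
(* A term of the atom-bond index is sqrt D * sqrt (D - 1) with D = J_2(d); in
   the stated radicals the part of D other than p ^ 2 - 1 is moved inside. *)
have abE : (s 6 = s 3 * s (3 - 1)) * (s 132 = 2 * s 3 * s (12 - 1)) *
    (s (q ^+ 2 - 2) = s (x - 1)) *
    (s (9 * q ^+ 2 - 12) = s 3 * s (3 * x - 1)) *
    (s (144 * q ^+ 2 - 156) = 2 * s 3 * s (12 * x - 1)) *
    (s (q ^+ 6 - q ^+ 4 - q ^+ 2) = q * s (q ^+ 2 * x - 1)) *
    (s (9 * q ^+ 6 - 9 * q ^+ 4 - 3 * q ^+ 2) =
       q * (s 3 * s (3 * (q ^+ 2 * x) - 1))) *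
    (s (144 * q ^+ 6 - 144 * q ^+ 4 - 12 * q ^+ 2) =
       q * (2 * s 3 * s (12 * (q ^+ 2 * x) - 1))).
  by do ![split]; rewrite -?s3M -?s12M -?sqM /x; congr s; ring.
have d3_gt0 : 0 < 3 * q ^+ 2 - 2 by nra.
have d12_gt0 : 0 < 12 * q ^+ 2 - 11 by nra.
have e1_gt0 : 0 < q ^+ 4 - q ^+ 2 + 1 by nra.
have e3_gt0 : 0 < 3 * q ^+ 4 - 3 * q ^+ 2 + 1 by nra.
have e12_gt0 : 0 < 12 * q ^+ 4 - 12 * q ^+ 2 + 1 by nra.
pose indicesE m n (oG : #|G| = (2 ^ m * p ^ n)%N) :=
  (randic_prime2 R cycG pr2 p_prime neq_2p oG,
   atom_bond_prime2 R cycG pr2 p_prime neq_2p oG,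
   geom_arith_prime2 R cycG pr2 p_prime neq_2p oG,
   harmonic_prime2 R cycG pr2 p_prime neq_2p oG,
   sum_connectivity_prime2 R cycG pr2 p_prime neq_2p oG).
pose radE := (s3M, s12M, sqM, s12, s1, sx3, mul1r, mulr1, subrr, s0).
split=> oG.
- rewrite !(indicesE 1 1 oG) !big_ord_recr !big_ord0 /= -/s -/q !add0r !jE.
  rewrite !radE ?abE ?dE ?s4 ?sq /x.
  by split; [ring | ring | ..]; field; rewrite !gt_eqF ?s_gt0.
- rewrite !(indicesE 1 2 oG) !big_ord_recr !big_ord0 /= -/s -/q !add0r !jE.
  rewrite !radE ?abE ?dE ?s4 ?sq /x.
  by split; [ring | ring | ..]; field; rewrite !gt_eqF ?s_gt0.
- rewrite !(indicesE 2 1 oG) !big_ord_recr !big_ord0 /= -/s -/q !add0r !jE.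
  rewrite !radE ?abE ?dE ?s4 ?sq /x.
  by split; [ring | ring | ..]; field; rewrite !gt_eqF ?s_gt0.
- rewrite !(indicesE 2 2 oG) !big_ord_recr !big_ord0 /= -/s -/q !add0r !jE.
  rewrite !radE ?abE ?dE ?s4 ?sq /x.
  by split; [ring | ring | ..]; field; rewrite !gt_eqF ?s_gt0.
Qed.
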